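(* Let $(\mathcal A;\mathcal E)$ be an exact category, let $\mathcal F$ be an additive exact substructure of $\mathcal E$, and let $u : X \to Y$ be a morphism in $\mathcal A$. The following assertions are equivalent: (1) $u$ is an $\mathcal F$-injective hull. (2) $u$ is an $\mathcal F$-inflation, $Y$ is $\mathcal F$-injective and $Y$ is $\mathcal F$-small over $X$. (3) $u$ is an $\mathcal F$-inflation, $Y$ is $\mathcal F$-injective and each morphism $f : Y \to Z$ such that $fu$ is an $\mathcal F$-inflation is a split monomorphism. If, in addition, $u$ has a cokernel and there exists an $\mathcal F$-inflation $v : X \to E$ with $E$ an $\mathcal F$-injective object, the following assertion is equivalent too: (4) $u$ is an $\mathcal F$-injective envelope. Finally, if there exists an $\mathcal F$-essential extension $v : X \to E$ with $E$ an $\mathcal F$-injective object, the following assertion is equivalent too (to (1), (2), (3)): (5) $u$ is a weakly $\mathcal F$-essential extension with $Y$ being $\mathcal F$-injective.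
   Context: $(\mathcal A;\mathcal E)$ is an exact category in the sense of Quillen: $\mathcal A$ is additive and $\mathcal E$ is a distinguished family of kernel-cokernel pairs (conflations) satisfying Quillen's axioms; the kernel of a conflation is an inflation. An additive exact substructure $\mathcal F$ of $\mathcal E$ is an exact structure on $\mathcal A$ each of whose conflations belongs to $\mathcal E$; its inflations are the $\mathcal F$-inflations. An object $E$ is $\mathcal F$-injective if every morphism $K\to E$ extends along every $\mathcal F$-inflation $K \to A$. An admissible subobject of $X$ is a subobject represented by an $\mathcal E$-inflation. An $\mathcal F$-partial morphism (resp. $\mathcal F$-partial isomorphism) $f$ from $X$ to $Y$ with $\operatorname{dom} f = U$ is a morphism $f : U \to Y$, where $U$ is an admissible subobject of $X$ with inclusion $u : U \to X$, such that in the pushout of $f$ along $u$, with $\overline u : Y \to P$ and $\overline f : X \to P$, $\overline u f = \overline f u$, the morphism $\overline u$ is an $\mathcal F$-inflation (resp. both $\overline u$ and $\overline f$ are $\mathcal F$-inflations). For an object $Y$ and an admissible subobject $X$ of $Y$ (with inclusion $u : X\to Y$), $Y$ is $\mathcal F$-small over $X$ if for any $\mathcal F$-partial morphism $f$ from $Y$ to another object $Z$ with $\operatorname{dom} f = Y$: if $f\upharpoonright X = fu$ is an $\mathcal F$-partial isomorphism from $Y$ to $Z$ (with domain $X$), then $f$ is an $\mathcal F$-partial isomorphism. A weakly $\mathcal F$-essential extension (resp. $\mathcal F$-essential extension) is an $\mathcal F$-inflation $u : X \to Y$ such that for any morphism $f : Y \to Z$, if $fu$ is an $\mathcal F$-inflation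 then $f$ is an inflation (resp. $f$ is an $\mathcal F$-inflation). An $\mathcal F$-injective hull of $X$ is an $\mathcal F$-essential extension $u : X \to E$ with $E$ an $\mathcal F$-injective object. An $\mathcal F$-injective envelope of $X$ is a morphism $u : X \to E$ with $E$ $\mathcal F$-injective such that every morphism $X \to E'$ with $E'$ $\mathcal F$-injective factors through $u$, and such that any $f : E \to E$ with $fu = u$ is an isomorphism.
   Formalization: The implication (3) ⇒ (1), and with it (4) ⇒ (1), (2), is proved only when every split monomorphism in 𝒜 has a cokernel, unless an F-essential extension of X into an F-injective object exists; without this the claim fails for general exact categories. (3) ⇔ (4) is proved as stated. *)

(* Defs.v *)
From mathcomp Require Import all_boot ssralg.

Set Implicit Arguments.
Unset Strict Implicit.
Unset Printing Implicit Defensive.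

Local Open Scope ring_scope.

Record preadditive := Preadditive {
  Ob :> Type;
  Hom : Ob -> Ob -> zmodType;
  idm : forall X, Hom X X;
  compm : forall X Y Z, Hom Y Z -> Hom X Y -> Hom X Z;
  compmA : forall W X Y Z (h : Hom Y Z) (g : Hom X Y) (f : Hom W X),
    compm h (compm g f) = compm (compm h g) f;
  comp1m : forall X Y (f : Hom X Y), compm (idm Y) f = f;
  compm1 : forall X Y (f : Hom X Y), compm f (idm X) = f;
  compDl : forall X Y Z (g h : Hom Y Z) (f : Hom X Y),
    compm (g + h) f = compm g f + compm h f;
  compDr : forall X Y Z (h : Hom Y Z) (f g : Hom X Y),
    compm h (f + g) = compm h f + compm h g
}.
Arguments Hom {p}.
Arguments idm {p}.
Arguments compm {p X Y Z}.

Notation "g \oc f" := (compm g f) (at level 40, left associativity) : ring_scope.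

Section Categorical.
Variable A : preadditive.
Implicit Types X Y Z T P : A.

Definition zero_object Z : Prop :=
  forall X, (forall f : Hom X Z, f = 0) /\ (forall f : Hom Z X, f = 0).

Definition is_biproduct X Y P (i1 : Hom X P) (i2 : Hom Y P)
    (p1 : Hom P X) (p2 : Hom P Y) : Prop :=
  [/\ p1 \oc i1 = idm X, p2 \oc i2 = idm Y, p1 \oc i2 = 0, p2 \oc i1 = 0
    & i1 \oc p1 + i2 \oc p2 = idm P].

Definition is_iso X Y (f : Hom X Y) : Prop :=
  exists g : Hom Y X, g \oc f = idm X /\ f \oc g = idm Y.

Definition split_mono X Y (f : Hom X Y) : Prop :=
  exists r : Hom Y X, r \oc f = idm X.

Definition is_kernel X Y Z (i : Hom X Y) (p : Hom Y Z) : Prop :=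
  p \oc i = 0 /\
  forall T (t : Hom T Y), p \oc t = 0 -> exists! s : Hom T X, i \oc s = t.

Definition is_cokernel X Y Z (i : Hom X Y) (p : Hom Y Z) : Prop :=
  p \oc i = 0 /\
  forall T (t : Hom Y T), t \oc i = 0 -> exists! s : Hom Z T, s \oc p = t.

Definition has_cokernel X Y (i : Hom X Y) : Prop :=
  exists Z (p : Hom Y Z), is_cokernel i p.

(* The square  u : X -> Y,  f : X -> Z,  ub : Z -> P,  fb : Y -> P; thus [ub]
   is the pushout of [u] along [f]. *)
Definition is_pushout X Y Z P (u : Hom X Y) (f : Hom X Z)
    (ub : Hom Z P) (fb : Hom Y P) : Prop :=
  ub \oc f = fb \oc u /\
  forall T (a : Hom Z T) (b : Hom Y T), a \oc f = b \oc u ->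
    exists! s : Hom P T, s \oc ub = a /\ s \oc fb = b.

(* The square  p : Y -> X,  f : Z -> X,  pb : P -> Z,  fb : P -> Y. *)
Definition is_pullback X Y Z P (p : Hom Y X) (f : Hom Z X)
    (pb : Hom P Z) (fb : Hom P Y) : Prop :=
  f \oc pb = p \oc fb /\
  forall T (a : Hom T Z) (b : Hom T Y), f \oc a = p \oc b ->
    exists! s : Hom T P, pb \oc s = a /\ fb \oc s = b.

End Categorical.

Record additiveCat := AdditiveCat {
  preadditive_of :> preadditive;
  has_zero : exists Z : preadditive_of, zero_object Z;
  has_biproducts : forall X Y : preadditive_of,
    exists P (i1 : Hom X P) (i2 : Hom Y P) (p1 : Hom P X) (p2 : Hom P Y),
      is_biproduct i1 i2 p1 p2
}.

(* Weak idempotent completeness. *)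
Definition weakly_idempotent_complete (A : additiveCat) : Prop :=
  forall (X Y : A) (f : Hom X Y), split_mono f -> has_cokernel f.

Definition conflation_class (A : additiveCat) :=
  forall X Y Z : A, Hom X Y -> Hom Y Z -> Prop.

Definition inflation_of (A : additiveCat) (C : conflation_class A)
    (X Y : A) (i : Hom X Y) : Prop :=
  exists (Z : A) (p : Hom Y Z), C X Y Z i p.

Definition deflation_of (A : additiveCat) (C : conflation_class A)
    (Y Z : A) (p : Hom Y Z) : Prop :=
  exists (X : A) (i : Hom X Y), C X Y Z i p.

(* Quillen's axioms in the form of Buehler, "Exact categories", Def. 2.1;
   Quillen's remaining ("obscure") axiom is a consequence of these. *)
Record exact_structure (A : additiveCat) := ExactStructure {
  conflation : conflation_class A;
  conflation_kercoker : forall X Y Z (i : Hom X Y) (p : Hom Y Z),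
    conflation i p -> is_kernel i p /\ is_cokernel i p;
  conflation_iso : forall X Y Z X' Y' Z' (i : Hom X Y) (p : Hom Y Z)
      (i' : Hom X' Y') (p' : Hom Y' Z')
      (a : Hom X X') (b : Hom Y Y') (c : Hom Z Z'),
    is_iso a -> is_iso b -> is_iso c ->
    b \oc i = i' \oc a -> c \oc p = p' \oc b ->
    conflation i p -> conflation i' p';
  inflation_id : forall X : A, inflation_of conflation (idm X);
  deflation_id : forall X : A, deflation_of conflation (idm X);
  inflation_comp : forall X Y Z (i : Hom X Y) (j : Hom Y Z),
    inflation_of conflation i -> inflation_of conflation j ->
    inflation_of conflation (j \oc i);
  deflation_comp : forall X Y Z (p : Hom X Y) (q : Hom Y Z),
    deflation_of conflation p -> deflation_of conflation q ->
    deflation_of conflation (q \oc p);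
  inflation_pushout : forall X Y X' (i : Hom X Y) (f : Hom X X'),
    inflation_of conflation i ->
    exists Y' (i' : Hom X' Y') (f' : Hom Y Y'),
      is_pushout i f i' f' /\ inflation_of conflation i';
  deflation_pullback : forall X Y X' (p : Hom Y X) (f : Hom X' X),
    deflation_of conflation p ->
    exists Y' (p' : Hom Y' X') (f' : Hom Y' Y),
      is_pullback p f p' f' /\ deflation_of conflation p'
}.

Section RelativeInjectivity.
Variable A : additiveCat.
Implicit Types (X Y Z : A) (E F : exact_structure A).

Definition inflation E X Y (i : Hom X Y) : Prop := inflation_of (conflation E) i.

Definition exact_substructure F E : Prop :=
  forall X Y Z (i : Hom X Y) (p : Hom Y Z), conflation F i p -> conflation E i p.

Definition injective_object F (Q : A) : Prop :=
  forall (K B : A) (i : Hom K B), inflation F i ->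
  forall g : Hom K Q, exists h : Hom B Q, h \oc i = g.

(* A partial morphism from [X] to [Y] is given by a representative
   [u : U -> X] of its domain together with [f : U -> Y]. *)
Definition partial_morphism E F X Y (U : A) (u : Hom U X) (f : Hom U Y) : Prop :=
  inflation E u /\
  exists P (ub : Hom Y P) (fb : Hom X P), is_pushout u f ub fb /\ inflation F ub.

Definition partial_isomorphism E F X Y (U : A) (u : Hom U X) (f : Hom U Y) : Prop :=
  inflation E u /\
  exists P (ub : Hom Y P) (fb : Hom X P),
    [/\ is_pushout u f ub fb, inflation F ub & inflation F fb].

Definition small_over E F X Y (u : Hom X Y) : Prop :=
  inflation E u /\
  forall Z (f : Hom Y Z), partial_morphism E F (idm Y) f ->
    partial_isomorphism E F u (f \oc u) -> partial_isomorphism E F (idm Y) f.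

Definition essential_extension F X Y (u : Hom X Y) : Prop :=
  inflation F u /\
  forall Z (f : Hom Y Z), inflation F (f \oc u) -> inflation F f.

Definition weakly_essential_extension E F X Y (u : Hom X Y) : Prop :=
  inflation F u /\
  forall Z (f : Hom Y Z), inflation F (f \oc u) -> inflation E f.

Definition injective_hull F X Y (u : Hom X Y) : Prop :=
  essential_extension F u /\ injective_object F Y.

Definition injective_envelope F X Y (u : Hom X Y) : Prop :=
  [/\ injective_object F Y,
      forall (Q : A) (g : Hom X Q), injective_object F Q ->
        exists h : Hom Y Q, h \oc u = g
    & forall f : Hom Y Y, f \oc u = u -> is_iso f].

End RelativeInjectivity.

(* Main.v *)
(** The obscure axiom (a morphism [g] with a cokernel is an inflation as soon
    as some [h g] is one) shows that restricting [f : Y -> Z] along an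
    inflation [u : X -> Y] gives an F-partial isomorphism exactly when [f u]
    is an F-inflation: the pushout of [f u] along [u] provides both the
    cokernel and the composite.  Hence smallness over [X] is essentiality.  The
    other equivalences use that inflations out of injectives split, and that a
    split monomorphism [h] between hulls has a retraction that is again a
    monomorphism, so that [h] is invertible. *)
Require Import Defs.
From mathcomp Require Import all_boot ssralg.
Local Open Scope ring_scope.
Import GRing.Theory.

Set Implicit Arguments.
Unset Strict Implicit.

(** * Universal constructions in a preadditive category *)

Section Preadditive.
Context {A : preadditive}.
Implicit Types X Y Z T P : A.

Lemma comp0m X Y Z (f : Hom X Y) : (0 : Hom Y Z) \oc f = 0.
Proof. by apply: (addIr (0 \oc f)); rewrite -compDl !add0r. Qed.

Lemma compm0 X Y Z (f : Hom Y Z) : f \oc (0 : Hom X Y) = 0.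
Proof. by apply: (addIr (f \oc 0)); rewrite -compDr !add0r. Qed.

Lemma compNm X Y Z (f : Hom Y Z) (g : Hom X Y) : (- f) \oc g = - (f \oc g).
Proof. by apply: (addIr (f \oc g)); rewrite -compDl !addNr comp0m. Qed.

Lemma compmN X Y Z (f : Hom Y Z) (g : Hom X Y) : f \oc (- g) = - (f \oc g).
Proof. by apply: (addIr (f \oc g)); rewrite -compDr !addNr compm0. Qed.

Lemma compBl X Y Z (f g : Hom Y Z) (h : Hom X Y) :
  (f - g) \oc h = f \oc h - g \oc h.
Proof. by rewrite compDl compNm. Qed.

Lemma compBr X Y Z (h : Hom Y Z) (f g : Hom X Y) :
  h \oc (f - g) = h \oc f - h \oc g.
Proof. by rewrite compDr compmN. Qed.

Lemma is_iso_id X : is_iso (idm X).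
Proof. by exists (idm X); rewrite comp1m. Qed.

Lemma split_mono_cancel X Y T (f : Hom X Y) (s t : Hom T X) :
  split_mono f -> f \oc s = f \oc t -> s = t.
Proof.
by case=> r rf e; rewrite -[s]comp1m -[t]comp1m -rf -!compmA e.
Qed.

(** Cancel [r] in [r \oc (h \oc r) = r]. *)
Lemma mono_retraction_iso X Y (h : Hom X Y) (r : Hom Y X) :
  r \oc h = idm X -> (forall T (s t : Hom T Y), r \oc s = r \oc t -> s = t) ->
  is_iso h.
Proof.
move=> rh rmono; exists r; split=> //.
by apply: rmono; rewrite compmA rh comp1m compm1.
Qed.

Lemma kernel_mono X Y Z (i : Hom X Y) (p : Hom Y Z) T (s t : Hom T X) :
  is_kernel i p -> i \oc s = i \oc t -> s = t.
Proof.
case=> pi0 univ e; have: p \oc (i \oc s) = 0 by rewrite compmA pi0 comp0m.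
by case/univ=> w [_ wuniq]; rewrite -(wuniq s) // -(wuniq t).
Qed.

Lemma cokernel_epi X Y Z (i : Hom X Y) (p : Hom Y Z) T (s t : Hom Z T) :
  is_cokernel i p -> s \oc p = t \oc p -> s = t.
Proof.
case=> pi0 univ e; have: (s \oc p) \oc i = 0 by rewrite -compmA pi0 compm0.
by case/univ=> w [_ wuniq]; rewrite -(wuniq s) // -(wuniq t).
Qed.

Lemma pushout_epi X Y Z P (u : Hom X Y) (f : Hom X Z) (ub : Hom Z P)
    (fb : Hom Y P) T (s t : Hom P T) :
  is_pushout u f ub fb -> s \oc ub = t \oc ub -> s \oc fb = t \oc fb -> s = t.
Proof.
case=> comm univ eu ef.
have: (s \oc ub) \oc f = (s \oc fb) \oc u by rewrite -!compmA comm.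
by case/univ=> w [_ wuniq]; rewrite -(wuniq s) // -(wuniq t).
Qed.

Lemma pullback_mono X Y Z P (p : Hom Y X) (f : Hom Z X) (pb : Hom P Z)
    (fb : Hom P Y) T (s t : Hom T P) :
  is_pullback p f pb fb -> pb \oc s = pb \oc t -> fb \oc s = fb \oc t -> s = t.
Proof.
case=> comm univ ep ef.
have: f \oc (pb \oc s) = p \oc (fb \oc s) by rewrite !compmA comm.
by case/univ=> w [_ wuniq]; rewrite -(wuniq s) // -(wuniq t).
Qed.

Lemma kernel_unique X X' Y Z (i : Hom X Y) (i' : Hom X' Y) (p : Hom Y Z) :
  is_kernel i p -> is_kernel i' p ->
  exists2 a : Hom X X', is_iso a & i' \oc a = i.
Proof.
move=> ki ki'; have [a [ea _]] := ki'.2 _ _ ki.1.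
have [b [eb _]] := ki.2 _ _ ki'.1; exists a => //; exists b; split.
  by apply: (kernel_mono ki); rewrite compmA eb ea compm1.
by apply: (kernel_mono ki'); rewrite compmA ea eb compm1.
Qed.

Lemma cokernel_unique X Y Z Z' (i : Hom X Y) (p : Hom Y Z) (p' : Hom Y Z') :
  is_cokernel i p -> is_cokernel i p' ->
  exists2 c : Hom Z Z', is_iso c & c \oc p = p'.
Proof.
move=> kp kp'; have [a [ea _]] := kp.2 _ _ kp'.1.
have [b [eb _]] := kp'.2 _ _ kp.1; exists a => //; exists b; split.
  by apply: (cokernel_epi kp); rewrite -compmA ea eb comp1m.
by apply: (cokernel_epi kp'); rewrite -compmA eb ea comp1m.
Qed.

Lemma pushout_unique X Y Z P P' (u : Hom X Y) (f : Hom X Z)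
    (ub : Hom Z P) (fb : Hom Y P) (ub' : Hom Z P') (fb' : Hom Y P') :
  is_pushout u f ub fb -> is_pushout u f ub' fb' ->
  exists b : Hom P P', [/\ is_iso b, b \oc ub = ub' & b \oc fb = fb'].
Proof.
move=> po po'; have [a [[ua fa] _]] := po.2 _ _ _ po'.1.
have [b [[ub1 fb1] _]] := po'.2 _ _ _ po.1.
exists a; split=> //; exists b; split.
  by apply: (pushout_epi po);
    rewrite -compmA comp1m ?ua ?fa.
by apply: (pushout_epi po');
  rewrite -compmA comp1m ?ub1 ?fb1.
Qed.

Lemma pullback_unique X Y Z P P' (p : Hom Y X) (f : Hom Z X)
    (pb : Hom P Z) (fb : Hom P Y) (pb' : Hom P' Z) (fb' : Hom P' Y) :
  is_pullback p f pb fb -> is_pullback p f pb' fb' ->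
  exists b : Hom P' P, [/\ is_iso b, pb \oc b = pb' & fb \oc b = fb'].
Proof.
move=> po po'; have [a [[pa fa] _]] := po.2 _ _ _ po'.1.
have [b [[pb1 fb1] _]] := po'.2 _ _ _ po.1.
exists a; split=> //; exists b; split.
  by apply: (pullback_mono po');
    rewrite compmA compm1 ?pb1 ?fb1.
by apply: (pullback_mono po);
  rewrite compmA compm1 ?pa ?fa.
Qed.

(** A map on [Z] killing [g] glues with the zero map on [Y] to a map on [P] killing [gb], which then
    factors through [q]. *)
Lemma pushout_cokernel X Y Z P Q (u : Hom X Y) (g : Hom X Z) (ub : Hom Z P)
    (gb : Hom Y P) (q : Hom P Q) :
  is_pushout u g ub gb -> is_cokernel gb q -> is_cokernel g (q \oc ub).
Proof.
move=> po kq; split=> [|T t tg0].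
  by rewrite -compmA po.1 compmA kq.1 comp0m.
have e : t \oc g = 0 \oc u by rewrite tg0 comp0m.
have [s [[su sg] _]] := po.2 _ _ _ e.
have [w [wq _]] := kq.2 _ _ sg.
exists w; split=> [|w' ew']; first by rewrite compmA wq.
apply: (cokernel_epi kq).
apply: (pushout_epi po).
  by rewrite wq su -compmA ew'.
by rewrite -!compmA kq.1 !compm0.
Qed.

Lemma pushout_id Y Z (f : Hom Y Z) : is_pushout (idm Y) f (idm Z) f.
Proof.
split=> [|T a b e]; first by rewrite comp1m compm1.
by exists a; split=> [|s [<- _]]; rewrite ?compm1 // e compm1.
Qed.

End Preadditive.

(** * Inflations, the obscure axiom and injectivity in one exact structure *)

Section ExactStructure.
Context {A : additiveCat} (F : exact_structure A).
Implicit Types X Y Z T P Q : A.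

Lemma conflation_of_cokernel X Y Z (i : Hom X Y) (p : Hom Y Z) :
  inflation F i -> is_cokernel i p -> conflation F i p.
Proof.
move=> [Z' [p' ip']] kp.
have [c isoc ec] := cokernel_unique (conflation_kercoker ip').2 kp.
by apply: (conflation_iso (is_iso_id _) (is_iso_id _) isoc _ _ ip');
  rewrite ?comp1m compm1.
Qed.

Lemma conflation_of_kernel X Y Z (i : Hom X Y) (p : Hom Y Z) :
  deflation_of (conflation F) p -> is_kernel i p -> conflation F i p.
Proof.
move=> [X' [i' ip']] ki.
have [a isoa ea] := kernel_unique (conflation_kercoker ip').1 ki.
by apply: (conflation_iso isoa (is_iso_id _) (is_iso_id _) _ _ ip');
  rewrite ?comp1m ?compm1.
Qed.

Lemma iso_inflation X Y (b : Hom X Y) : is_iso b -> inflation F b.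
Proof.
move=> isob; have [Z [p ip]] := inflation_id F X; have [b' [b'b _]] := isob.
exists Z, (p \oc b').
apply: (conflation_iso (is_iso_id _) isob (is_iso_id _) _ _ ip) => //.
by rewrite comp1m -compmA b'b compm1.
Qed.

Lemma iso_deflation X Y (b : Hom X Y) :
  is_iso b -> deflation_of (conflation F) b.
Proof.
move=> isob; have [K [i ip]] := deflation_id F X.
exists K, i.
by apply: (conflation_iso (is_iso_id _) (is_iso_id _) isob _ _ ip);
  rewrite ?comp1m ?compm1.
Qed.

Lemma pushout_inflation X Y Z P (i : Hom X Y) (f : Hom X Z) (ib : Hom Z P)
    (fb : Hom Y P) :
  inflation F i -> is_pushout i f ib fb -> inflation F ib.
Proof.
move=> infi po; have [P' [i' [f' [po' infi']]]] := inflation_pushout f infi.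
have [b [isob <- _]] := pushout_unique po' po.
exact: inflation_comp infi' (iso_inflation isob).
Qed.

Lemma pullback_deflation X Y Z P (p : Hom Y X) (f : Hom Z X) (pb : Hom P Z)
    (fb : Hom P Y) :
  deflation_of (conflation F) p -> is_pullback p f pb fb ->
  deflation_of (conflation F) pb.
Proof.
move=> defp po; have [P' [p' [f' [po' defp']]]] := deflation_pullback f defp.
have [b [isob <- _]] := pullback_unique po' po.
exact: deflation_comp (iso_deflation isob) defp'.
Qed.

Lemma inflation_mono X Y T (i : Hom X Y) (s t : Hom T X) :
  inflation F i -> i \oc s = i \oc t -> s = t.
Proof. by case=> Z [p /conflation_kercoker[ki _]]; apply: kernel_mono ki. Qed.

(** The endomorphism [idm Y - f \oc r] kills [f], so it is [s \oc c] with [s] a section of [c]; thus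
    [Y] is the biproduct of [X] and [C]. *)
Lemma split_mono_inflation X Y (f : Hom X Y) :
  split_mono f -> has_cokernel f -> inflation F f.
Proof.
move=> [r rf] [C [c kc]].
have /kc.2[s [sc _]] : (idm Y - f \oc r) \oc f = 0.
  by rewrite compBl comp1m -compmA rf compm1 subrr.
have cs : c \oc s = idm C.
  apply: (cokernel_epi kc).
  by rewrite -compmA sc compBr compm1 compmA kc.1 !comp0m subr0 comp1m.
have rs : r \oc s = 0.
  apply: (cokernel_epi kc).
  by rewrite -compmA sc compBr compm1 compmA rf comp1m subrr comp0m.
have [K [k confk]] := deflation_id F C.
have k0 : k = 0 by have [[+ _] _] := conflation_kercoker confk; rewrite comp1m.
(* [K] is a zero object, so [f] is the pushout of [0 -> C] along [0 -> X]. *)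
have infk : inflation F k by exists C, (idm C).
apply: (pushout_inflation (f := 0) (fb := s) infk); rewrite k0.
split=> [|T a b _]; first by rewrite !compm0.
exists (a \oc r + b \oc c); split=> [|w [<- <-]].
  by rewrite !compDl -!compmA rf rs cs kc.1 !compm0 !compm1 addr0 add0r.
by rewrite -!compmA sc -compDr addrC subrK compm1.
Qed.

(** The obscure axiom takes for [f] the morphism to be tested and for [g] the composite known to be
    an inflation. *)
Lemma inflation_pair X Y Z W (i1 : Hom Y W) (i2 : Hom Z W) (p1 : Hom W Y)
    (p2 : Hom W Z) (f : Hom X Y) (g : Hom X Z) :
  is_biproduct i1 i2 p1 p2 -> inflation F g ->
  inflation F (i1 \oc f + i2 \oc g).
Proof.
move=> [p1i1 p2i2 p1i2 p2i1 sum1] infg.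
have [V [j1 [j2 [q1 [q2 [q1j1 q2j2 q1j2 q2j1 sum2]]]]]] := has_biproducts Y X.
(* The pair factors as [X -> Y + X -> Y + Z], a split monomorphism followed
   by the pushout [1 + g] of [g]. *)
have -> : i1 \oc f + i2 \oc g
    = (i1 \oc q1 + i2 \oc g \oc q2) \oc (j1 \oc f + j2).
  rewrite !(compDl, compDr) -!compmA !(compmA _ j1) q1j1 q2j1 q1j2 q2j2.
  by rewrite !comp0m !comp1m !compm0 !compm1 addr0 add0r.
apply: inflation_comp.
  apply: split_mono_inflation.
    by exists q2; rewrite compDr compmA q2j1 comp0m add0r.
  (* The graph of [f] is cut out by [q1 = f \oc q2]; the difference of the two sides is its
     cokernel. *)
  exists Y, (q1 - f \oc q2); split=> [|T t].
    rewrite compBl !compDr -!compmA !(compmA _ j1) q1j1 q1j2 q2j1 q2j2.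
    by rewrite !comp0m compm0 comp1m compm1 add0r addr0 subrr.
  rewrite compDr => /eqP; rewrite addr_eq0 => /eqP e.
  exists (t \oc j1); split=> [|s <-].
    rewrite compBr !compmA -[t \oc j1 \oc f]compmA e compNm opprK -!compmA.
    by rewrite -compDr sum2 compm1.
  by rewrite -compmA compBl -compmA q1j1 q2j1 compm0 subr0 compm1.
apply: (pushout_inflation (f := j2) (fb := i2) infg); split=> [|T a b e].
  by rewrite compDl -!compmA q1j2 q2j2 compm0 add0r compm1.
exists (a \oc j1 \oc p1 + b \oc p2); split=> [|s [<- <-]].
  split; last by rewrite compDl -!compmA p1i2 p2i2 !compm0 add0r compm1.
  rewrite !(compDl, compDr) -!compmA !(compmA p1) !(compmA p2).
  rewrite p1i1 p1i2 p2i1 p2i2 !comp0m !comp1m !compm0 addr0 add0r.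
  by rewrite (compmA b) -e -compmA -compDr sum2 compm1.
rewrite -!(compmA s) -compDr !compDl -!compmA !(compmA _ j1) q1j1 q2j1.
by rewrite comp0m !compm0 addr0 comp1m sum1 compm1.
Qed.

(** The pair [m] of [i] and [j \oc i] is an inflation, so its cokernel [q] is a deflation, and so is
    the pullback [k] of [q]. It remains to see that [i] is the kernel of [k]. *)
Lemma obscure_axiom X Y Z (i : Hom X Y) (j : Hom Y Z) :
  has_cokernel i -> inflation F (j \oc i) -> inflation F i.
Proof.
move=> [C [k kk]] infji.
have [V [i1 [i2 [p1 [p2 bpV]]]]] := has_biproducts Y Z.
have [p1i1 p2i2 p1i2 p2i1 sum1] := bpV.
have [W [j1 [j2 [q1 [q2 [q1j1 q2j2 q1j2 q2j1 sum2]]]]]] := has_biproducts C Z.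
pose m := i1 \oc i + i2 \oc (j \oc i).
have infm : inflation F m := inflation_pair i bpV infji.
(* [m] is the graph of [j] restricted to [X], so its cokernel sends
   [(y, z)] to [(k y, z - j y)]; pulling back along [C -> C + Z] gives [k]. *)
pose n := i1 + i2 \oc j.
have mE : m = n \oc i by rewrite /m /n compDl compmA.
have p1n : p1 \oc n = idm Y by rewrite /n compDr compmA p1i1 p1i2 comp0m addr0.
have p2n : p2 \oc n = j by rewrite /n compDr compmA p2i1 p2i2 comp1m add0r.
pose q := j1 \oc k \oc p1 + j2 \oc (p2 - j \oc p1).
have qn : q \oc n = j1 \oc k.
  rewrite {1}/q compDl -!compmA compBl -[(j \oc p1) \oc n]compmA p1n p2n.
  by rewrite !compm1 subrr compm0 addr0.
have qi2 : q \oc i2 = j2.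
  rewrite /q compDl -!compmA compBl -compmA p1i2 p2i2 !compm0.
  by rewrite subr0 add0r compm1.
have kq : is_cokernel m q.
  split=> [|T t]; first by rewrite mE compmA qn -compmA kk.1 compm0.
  rewrite mE compmA => /kk.2[s [sk _]].
  (* The factorization of [t] is prescribed on the summands: on [Z] by [t \oc i2], on [C] by the
     factor [s] of [t \oc n] through [k]. *)
  pose w := s \oc q1 + t \oc i2 \oc q2.
  have wj1 : w \oc j1 = s.
    by rewrite /w compDl -!compmA q1j1 q2j1 !compm0 addr0 compm1.
  have wj2 : w \oc j2 = t \oc i2.
    by rewrite /w compDl -!compmA q1j2 q2j2 !compm0 add0r compm1.
  exists w; split=> [|w' e].
    rewrite /q compDr !compmA wj1 wj2 sk -!compmA -compDr /n compDl compBr.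
    by rewrite -compmA addrC addrACA addNr addr0 addrC sum1 compm1.
  rewrite /w; have -> : s = w' \oc j1.
    by apply: (cokernel_epi kk); rewrite sk -e -compmA qn compmA.
  by rewrite -e -!compmA (compmA q) qi2 -compDr sum2 compm1.
have confmq := conflation_of_cokernel infm kq.
have km := (conflation_kercoker confmq).1.
have defk : deflation_of (conflation F) k.
  apply: (pullback_deflation (p := q) (f := j1) (fb := n)).
    by exists X, m.
  split=> [//|T a b e].
  (* The second coordinate of [e] reads [p2 \oc b = j \oc p1 \oc b]: [b] lands in the graph of
     [j]. *)
  have nb : n \oc (p1 \oc b) = b.
    have /(congr1 (fun x => q2 \oc x)) := e.
    rewrite compmA q2j1 comp0m /q compDl compDr !compmA q2j1 q2j2 !comp0m.
    rewrite add0r comp1m compBl => /esym/eqP; rewrite subr_eq0 => /eqP e2.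
    by rewrite /n compDl -[RHS]comp1m -sum1 !compDl -!compmA e2 !compmA.
  exists (p1 \oc b); split=> [|s [_ <-]]; last by rewrite compmA p1n comp1m.
  split=> //; have: j1 \oc (k \oc (p1 \oc b)) = j1 \oc a.
    by rewrite compmA -qn -compmA nb e.
  by apply: split_mono_cancel; exists q1.
exists C, k; apply: conflation_of_kernel => //; split=> [|T t kt0].
  exact: kk.1.
(* The kernel property passes from [m] to [i]: [n \oc t] factors through [m = n \oc i], and [p1]
   cancels [n]. *)
have /km.2[s [ms _]] : q \oc (n \oc t) = 0.
  by rewrite compmA qn -compmA kt0 compm0.
exists s; split=> [|s' is'].
  by rewrite -[t]comp1m -p1n -compmA -ms mE !compmA p1n comp1m.
by apply: (kernel_mono km); rewrite ms mE -compmA is'.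
Qed.

Lemma inflation_injective_split Y Z (f : Hom Y Z) :
  injective_object F Y -> inflation F f -> split_mono f.
Proof. by move=> injY /injY /(_ (idm Y)). Qed.

(** Forward, the obscure axiom applies to [ub \oc g = gb \oc u], a composite of inflations; a
    cokernel of [gb] yields one of [g]. *)
Lemma pushout_inflation_iff X Y Z P (u : Hom X Y) (g : Hom X Z)
    (ub : Hom Z P) (gb : Hom Y P) :
  inflation F u -> is_pushout u g ub gb -> (inflation F gb <-> inflation F g).
Proof.
move=> infu po; split=> [infgb|infg].
  have [Q [q /conflation_kercoker[_ kq]]] := infgb.
  apply: (obscure_axiom (j := ub)).
    by exists Q, (q \oc ub); apply: pushout_cokernel po kq.
  by rewrite po.1; apply: inflation_comp.
(* Transposed, the square shows [gb] as the pushout of [g] along [u]. *)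
apply: (pushout_inflation (f := u) (fb := ub) infg).
split=> [|T a b e]; first by rewrite po.1.
have [s [[su sg] suniq]] := po.2 _ _ _ (esym e).
by exists s; split=> // w [wg wu]; apply: suniq.
Qed.

(** Common core of the returns to (1) from (3) and (5). The map [h] from the hull [v] to [u] has a
    retraction [r] with [r \oc u = v]; once [r] is a monomorphism, [h] is invertible and [u]
    inherits essentiality from [v]. *)
Lemma essential_of_retractions X Y Q (u : Hom X Y) (v : Hom X Q) :
  inflation F u -> injective_object F Y ->
  essential_extension F v -> injective_object F Q ->
  (forall r : Hom Y Q, inflation F (r \oc u) ->
     forall T (s t : Hom T Y), r \oc s = r \oc t -> s = t) ->
  essential_extension F u.
Proof.
move=> infu injY [infv essv] injQ mono; split=> // Z f inffu.
have [h hv] := injY _ _ _ infv u.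
have infh : inflation F h by apply: essv; rewrite hv.
have [r rh] := inflation_injective_split injQ infh.
have [h' [h'h hh']] : is_iso h.
  apply: (mono_retraction_iso rh); apply: mono.
  by rewrite -hv compmA rh comp1m.
(* Now [f = (f \oc h) \oc h'], and essentiality of [v] applies to [f \oc h], since
   [f \oc h \oc v = f \oc u]. *)
rewrite -(compm1 f) -hh' compmA; apply: inflation_comp.
  by apply: iso_inflation; exists h.
by apply: essv; rewrite -compmA hv.
Qed.

Lemma envelope_of_split X Y (u : Hom X Y) :
  inflation F u -> injective_object F Y ->
  (forall Z (f : Hom Y Z), inflation F (f \oc u) -> split_mono f) ->
  injective_envelope F u.
Proof.
move=> infu injY split_ext; split=> // [Q g injQ|f fu]; first exact: injQ.
have [r rf] : split_mono f by apply: split_ext; rewrite fu.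
apply: (mono_retraction_iso rf) => T s t; apply: split_mono_cancel.
(* The retraction fixes [u] too: [r \oc u = r \oc f \oc u = u]. So [r] is itself a split
   monomorphism. *)
by apply: split_ext; rewrite -{1}fu compmA rf comp1m.
Qed.

(** The inflation [v] factors through [u], so the obscure axiom applies to [u]. Extending [u] along
    [f \oc u] gives [g] with [g \oc f] fixing [u], hence invertible. *)
Lemma split_of_envelope X Y Q (u : Hom X Y) (v : Hom X Q) :
  has_cokernel u -> inflation F v -> injective_object F Q ->
  injective_envelope F u ->
  inflation F u /\
  forall Z (f : Hom Y Z), inflation F (f \oc u) -> split_mono f.
Proof.
move=> cku infv injQ [injY ext isoY]; split.
  have [h hu] := ext _ v injQ.
  by apply: (obscure_axiom (j := h)) => //; rewrite hu.
move=> Z f inffu; have [g gfu] := injY _ _ _ inffu u.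
have [h [hgf _]] : is_iso (g \oc f) by apply: isoY; rewrite -compmA.
by exists (h \oc g); rewrite -compmA.
Qed.

End ExactStructure.

(** * Partial morphisms and smallness for a substructure *)

Section Substructure.
Context {A : additiveCat} (E F : exact_structure A).
Hypothesis subFE : exact_substructure F E.

Lemma substructure_inflation (X Y : A) (i : Hom X Y) :
  inflation F i -> inflation E i.
Proof. by case=> Z [p ip]; exists Z, p; apply: subFE. Qed.

Lemma partial_isomorphism_inflation (X Y Z : A) (u : Hom X Y) (g : Hom X Z) :
  inflation F u -> partial_isomorphism E F u g <-> inflation F g.
Proof.
move=> infu; split=> [[_ [P [ub [gb [po _ infgb]]]]]|infg].
  exact/(pushout_inflation_iff infu po).
have [P [ub [gb [po infub]]]] := inflation_pushout g infu.
split; first exact: substructure_inflation.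
by exists P, ub, gb; split=> //; apply/(pushout_inflation_iff infu po).
Qed.

(** In the pushout along [idm Y], the side opposite to it is [idm Z], an inflation. *)
Lemma total_partial_morphism (Y Z : A) (f : Hom Y Z) :
  partial_morphism E F (idm Y) f.
Proof.
split; first exact: inflation_id.
by exists Z, (idm Z), f; split; [apply: pushout_id | apply: inflation_id].
Qed.

(** The criterion for partial isomorphisms is used twice: at [u] for the restriction, at [idm Y] for
    [f] itself. *)
Lemma small_over_essential (X Y : A) (u : Hom X Y) :
  inflation F u -> small_over E F u <-> essential_extension F u.
Proof.
move=> infu; have infI : inflation F (idm Y) := inflation_id F Y.
split=> [[_ small]|[_ ess]].
  split=> // Z f /(partial_isomorphism_inflation _ infu).
  move/(small _ _ (total_partial_morphism f)).
  by move/(partial_isomorphism_inflation _ infI).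
split=> [|Z f _ /(partial_isomorphism_inflation _ infu)/ess inff].
  exact: substructure_inflation.
exact/(partial_isomorphism_inflation _ infI).
Qed.

End Substructure.

(** Returning from [S3] to [S1] asks that a split monomorphism be an F-inflation, so that it has a
    cokernel: weak idempotent completeness provides it, and otherwise a given hull [v] serves for
    comparison. *)
Theorem theorem3p10 (A : additiveCat) (E F : exact_structure A)
    (subFE : exact_substructure F E) (X Y : A) (u : Hom X Y) :
  let S1 := injective_hull F u in
  let S2 := [/\ inflation F u, injective_object F Y & small_over E F u] in
  let S3 := [/\ inflation F u, injective_object F Y
              & forall (Z : A) (f : Hom Y Z), inflation F (f \oc u) -> split_mono f] in
  let S4 := injective_envelope F u in
  let S5 := weakly_essential_extension E F u /\ injective_object F Y in
  [/\ S1 <-> S2,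
      S2 -> S3,
      weakly_idempotent_complete A -> S3 -> S1,
      has_cokernel u ->
        (exists (Q : A) (v : Hom X Q), inflation F v /\ injective_object F Q) ->
        (S3 <-> S4)
    & (exists (Q : A) (v : Hom X Q), essential_extension F v /\ injective_object F Q) ->
        [/\ S1 <-> S2, S1 <-> S3 & S1 <-> S5]].
Proof.
move=> S1 S2 S3 S4 S5.
have S12 : S1 <-> S2.
  split=> [[essu injY]|[infu injY smallu]].
    by split=> //; [exact: essu.1 | apply/(small_over_essential subFE essu.1)].
  by split=> //; apply/(small_over_essential subFE infu).
have S13 : S1 -> S3.
  move=> [[infu essu] injY]; split=> // Z f /essu.
  exact: inflation_injective_split.
split=> //.
- by move/S12.2.
- move=> wic [infu injY split_ext]; split=> //; split=> // Z f /split_ext sf.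
  by apply: split_mono_inflation => //; apply: wic.
- move=> cku [Q [v [infv injQ]]]; split=> [[infu injY split_ext]|env].
    exact: envelope_of_split.
  have [infu split_ext] := split_of_envelope cku infv injQ env.
  by split=> //; case: env.
- move=> [Q [v [essv injQ]]]; split=> //; split=> //.
  + move=> [infu injY split_ext]; split=> //.
    apply: (essential_of_retractions (v := v)) => // r /split_ext sr T s t.
    exact: split_mono_cancel.
  + move=> [[infu essu] injY]; split=> //; split=> // Z f /essu.
    exact: substructure_inflation.
  (* Weak essentiality makes [r] an inflation of [E] only, but that already makes it a
     monomorphism. *)
  + move=> [[infu wessu] injY]; split=> //.
    apply: (essential_of_retractions (v := v)) => // r /wessu infr T s t.
    exact: (inflation_mono infr).
Qed.
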